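(* Let $k$ be an algebraically closed field of characteristic $0$ and let $i\in k$ be a square root of $-1$. Let $G=(C_2)^2=\langle g_1,g_2\rangle$ and let $\mu$ be the 2-cocycle on $G$ defined by $\mu(g_1^pg_2^q,g_1^rg_2^s)=(-1)^{ps}$ for all $p,q,r,s\in\{0,1\}$. Fix the isomorphism $G\cong G^\vee$, $g\mapsto\chi_g$, where for $g,h\in G$, $\chi_g(h)=1$ if $g=e$ or $h\in\{e,g\}$, and $\chi_g(h)=-1$ otherwise. Let $G$ act on each of the algebras $\mathcal{A}(1,-1)$, $\mathcal{B}(1)$, $\mathcal{E}(1,\gamma)$, $\mathcal{G}(1,\gamma)$ (generated by $x_1,x_2,x_3$) by algebra automorphisms so that $g_1$ interchanges $x_1$ and $x_2$ and fixes $x_3$, and $g_2$ fixes $x_1,x_2$ and sends $x_3\mapsto-x_3$. Then there are $k$-algebra isomorphisms $$\mathcal{A}(1,-1)^{G,\mu}\cong\mathcal{D}(1,1),\qquad \mathcal{B}(1)^{G,\mu}\cong\mathcal{C}(1),$$ $$\mathcal{E}(1,\gamma)^{G,\mu}\cong\mathcal{E}(1,-\gamma)\ \text{ for }\gamma=\pm i,\qquad \mathcal{G}(1,\gamma)^{G,\mu}\cong\mathcal{G}(1,\overline{\gamma})\ \text{ for }\gamma=\tfrac{1+i}{2},\ \overline{\gamma}=\tfrac{1}{2\gamma}=\tfrac{1-i}{2}.$$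
   Context: Cocycle twist: let $G$ be a finite abelian group acting on a $k$-algebra $A$ by algebra automorphisms ($a\mapsto a^g$), with a fixed isomorphism $g\mapsto\chi_g$ from $G$ to $G^\vee=\operatorname{Hom}(G,k^\times)$. Then $A=\bigoplus_{g\in G}A_g$ is $G$-graded with $A_g=\{a:a^h=\chi_{g^{-1}}(h)a\ \forall h\in G\}$, and $A^{G,\mu}$ is the vector space $A$ with multiplication $a\ast_\mu b=\mu(g,h)ab$ for $a\in A_g$, $b\in A_h$, extended bilinearly. The algebras (members of families in Rogalski and Zhang's classification of AS-regular algebras of dimension 4): each is the quotient of the free algebra $k\langle x_1,x_2,x_3\rangle$ by four relations, which we write in terms of $w_1=x_1+x_2$, $w_2=x_1-x_2$, $w_3=x_3$. Notation: $[x,y]=xy-yx$, $[x,y]_+=xy+yx$. The algebras $\mathcal{A}(1,-1),\mathcal{B}(1),\mathcal{C}(1),\mathcal{D}(1,1)$ share the three relations $w_1^2-w_2^2=0$, $w_3w_1-w_1w_3=0$, $w_3^2w_2-w_2w_3^2=0$. The fourth relation is: for $\mathcal{A}(1,-1)$: $[w_3,[w_1,w_2]_+]=0$; for $\mathcal{B}(1)$: $[w_3,[w_2,w_1]]_+=0$; for $\mathcal{C}(1)$: $[w_3,[w_1,w_2]]=0$; for $\mathcal{D}(1,1)$: $[w_3,[w_1,w_2]_+]_+=0$. The algebras $\mathcal{E}(1,\gamma)$ ($\gamma=\pm i$) and $\mathcal{G}(1,\gamma)$ ($\gamma=\tfrac{1\pm i}{2}$) share the three relations $w_1^2-w_2^2=0$,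 $w_3w_1-w_1w_3=0$, $w_3^2w_2+w_2w_3^2=0$. The fourth relation is: for $\mathcal{E}(1,\gamma)$: $w_3w_2w_1-w_1w_3w_2+\gamma w_1w_2w_3-\gamma w_2w_1w_3=0$; for $\mathcal{G}(1,\tfrac{1+i}{2})$: $w_3w_1w_2+w_3w_2w_1+i\,w_1w_2w_3+i\,w_2w_1w_3=0$; for $\mathcal{G}(1,\tfrac{1-i}{2})$: $w_3w_1w_2+w_3w_2w_1-i\,w_1w_2w_3-i\,w_2w_1w_3=0$. *)

(* Defs.v *)
From HB Require Import structures.
From mathcomp Require Import all_boot all_order all_algebra all_fingroup.
From mathcomp Require Import generic_quotient ring_quotient boolp.
From mathcomp.finmap Require Import finmap.
From mathcomp.multinomials Require Import monalg.

Set Implicit Arguments.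
Unset Strict Implicit.
Unset Printing Implicit Defensive.

Import GRing.Theory.

Local Open Scope ring_scope.

Definition alg_iso (k : fieldType) (A B : algType k) : Prop :=
  exists f : {lrmorphism A -> B}, bijective f.

(* -------------------------------------------------------------------- *)
(* Cocycle twists                                                       *)
(* -------------------------------------------------------------------- *)

(* An isomorphism [g |-> chi g] from [G] to [Hom(G, k^x)]; homomorphisms  *)
(* to [k^x] are represented as functions to [k] mapping 1 to 1 and        *)
(* products to products, which therefore only take nonzero values.        *)
(* [dual_order] allows averaging over [G]; it holds in characteristic 0.  *)
Record dual_iso (k : fieldType) (G : finGroupType) := DualIso {
  dual_chi :> G -> G -> k;
  dual_hom1 : forall g, dual_chi g 1%g = 1;
  dual_homM : forall g x y,
    dual_chi g (x * y)%g = dual_chi g x * dual_chi g y;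
  dual_mul : forall g h x,
    dual_chi (g * h)%g x = dual_chi g x * dual_chi h x;
  dual_inj : forall g h, (forall x, dual_chi g x = dual_chi h x) -> g = h;
  dual_surj : forall f : G -> k,
    f 1%g = 1 -> (forall x y, f (x * y)%g = f x * f y) ->
    exists g, forall x, f x = dual_chi g x;
  dual_order : #|G|%:R != 0 :> k
}.

(* Normalised 2-cocycles on [G] with values in [k^x], trivial action.    *)
Record cocycle2 (k : fieldType) (G : finGroupType) := Cocycle2 {
  cocycle_fun :> G -> G -> k;
  cocycle_neq0 : forall g h, cocycle_fun g h != 0;
  cocycleA : forall g h l,
    cocycle_fun g h * cocycle_fun (g * h)%g l =
    cocycle_fun g (h * l)%g * cocycle_fun h l;
  cocycle1g : forall g, cocycle_fun 1%g g = 1;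
  cocycleg1 : forall g, cocycle_fun g 1%g = 1
}.

(* Right actions by algebra automorphisms; [alg_act g a] is a^g.             *)
Record alg_action (k : fieldType) (G : finGroupType) (A : algType k) :=
  AlgAction {
    act :> G -> {lrmorphism A -> A};
    alg_act1 : forall a, act 1%g a = a;
    alg_actM : forall g h a, act (g * h)%g a = act h (act g a)
  }.

Section Grading.
Variables (k : fieldType) (G : finGroupType) (A : algType k).
Variables (chi : dual_iso k G) (rho : alg_action G A).

Definition homog (g : G) (a : A) : Prop :=
  forall h, rho h a = chi g^-1%g h *: a.

(* The projection of A onto its component of degree g; see [homog_comp], *)
(* [sum_comp], [comp_id] and [comp_neq] below.                           *)
Definition hcomp (g : G) (a : A) : A :=
  #|G|%:R^-1 *: \sum_(h : G) chi g h *: rho h a.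

Lemma chi1g x : chi 1%g x = 1.
Proof.
have := dual_mul chi 1%g 1%g x; rewrite mulg1 => e.
have nz : chi 1%g x != 0.
  apply/eqP=> z; have := dual_homM chi 1%g x x^-1%g.
  by rewrite mulgV dual_hom1 z mul0r => /eqP; rewrite oner_eq0.
by apply: (mulfI nz); rewrite -e mulr1.
Qed.

Lemma chiVM g x : chi g^-1%g x * chi g x = 1.
Proof. by rewrite -dual_mul mulVg chi1g. Qed.

Lemma chiV g x : chi g x^-1%g = chi g^-1%g x.
Proof.
have nz : chi g x != 0.
  by apply/eqP=> z; have := chiVM g x; rewrite z mulr0 => /esym/eqP;
    rewrite oner_eq0.
by apply: (mulIf nz); rewrite chiVM -dual_homM mulVg dual_hom1.
Qed.

Lemma sum_chi g : \sum_(x : G) chi g x = (#|G| * (g == 1%g))%:R.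
Proof.
case: eqP => [->|ng].
  by under eq_bigr do rewrite chi1g; rewrite sumr_const muln1.
rewrite muln0; have [y ny] : exists y, chi g y != 1.
  apply/existsP; apply: contra_notT ng; rewrite negb_exists => /forallP h.
  by apply: (@dual_inj _ _ chi) => x; rewrite chi1g; apply/eqP; rewrite -[_ == _]negbK h.
apply/eqP; move: ny; apply: contraR => nz; apply/eqP.
apply: (mulIf nz); rewrite mul1r [RHS](reindex_inj (mulgI y)) /=.
by rewrite mulr_sumr; apply: eq_bigr => x _; rewrite dual_homM.
Qed.

Lemma sum_chi_dual x : \sum_(g : G) chi g x = (#|G| * (x == 1%g))%:R.
Proof.
pose M := \matrix_(i < #|G|, j < #|G|) chi (enum_val i) (enum_val j).
pose N := \matrix_(i < #|G|, j < #|G|)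
  (#|G|%:R^-1 * chi (enum_val j) (enum_val i)^-1%g).
have MN : M *m N = 1%:M.
  apply/matrixP=> i j; rewrite !mxE.
  have -> : \sum_l M i l * N l j =
     #|G|%:R^-1 * \sum_(x : G) chi (enum_val i * (enum_val j)^-1)%g x.
    rewrite mulr_sumr (reindex (@enum_val G predT)) /=; last first.
      by apply: onW_bij; apply: enum_val_bij.
    by apply: eq_bigr => l _; rewrite !mxE dual_mul chiV mulrCA.
  rewrite sum_chi -eq_mulgV1 (inj_eq enum_val_inj).
  by case: eqP => _; rewrite ?muln1 ?mulVf ?dual_order // muln0 mulr0.
have /matrixP/(_ (enum_rank 1%g) (enum_rank x)) := mulmx1C MN.
rewrite !mxE (inj_eq enum_rank_inj) eq_sym.
have -> : \sum_l N (enum_rank 1%g) l * M l (enum_rank x) =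
   #|G|%:R^-1 * \sum_(g : G) chi g x.
  rewrite mulr_sumr [RHS](reindex (@enum_val G predT)) /=; last first.
    by apply: onW_bij; apply: enum_val_bij.
  by apply: eq_bigr => l _; rewrite !mxE !enum_rankK invg1 dual_hom1 mulr1.
move/(congr1 ( *%R #|G|%:R)); rewrite mulVKf ?dual_order // => ->.
by rewrite natrM.
Qed.

Lemma homog_comp g a : homog g (hcomp g a).
Proof.
move=> h; rewrite /hcomp linearZ linear_sum /= scalerA mulrC -scalerA.
congr (_ *: _); rewrite scaler_sumr [RHS](reindex_inj (mulIg h)) /=.
apply: eq_bigr => x _.
by rewrite linearZ /= alg_actM scalerA dual_homM mulrCA chiVM mulr1.
Qed.

Lemma sum_comp a : \sum_g hcomp g a = a.
Proof.
rewrite -scaler_sumr exchange_big /= (bigD1 1%g) //= -scaler_suml.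
rewrite sum_chi_dual eqxx muln1 alg_act1 big1 ?addr0 => [|x /negPf nx].
  by rewrite scalerA mulVf ?dual_order // scale1r.
by rewrite -scaler_suml sum_chi_dual nx muln0 scale0r.
Qed.

Lemma comp_homog g h a : homog g a -> hcomp h a = (h == g)%:R *: a.
Proof.
move=> ha; rewrite /hcomp; under eq_bigr => x _ do
  rewrite ha scalerA -dual_mul.
rewrite -scaler_suml sum_chi scalerA -eq_mulgV1; case: eqP => _.
  by rewrite muln1 mulVf ?dual_order.
by rewrite muln0 mulr0.
Qed.

Lemma comp_id g a : homog g a -> hcomp g a = a.
Proof. by move/comp_homog->; rewrite eqxx scale1r. Qed.

Lemma comp_neq g h a : homog g a -> h != g -> hcomp h a = 0.
Proof. by move/comp_homog-> => /negPf->; rewrite scale0r. Qed.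

Lemma homog1 : homog 1%g 1.
Proof. by move=> h; rewrite invg1 chi1g scale1r rmorph1. Qed.

Lemma homogM g h a b : homog g a -> homog h b -> homog (g * h)%g (a * b).
Proof.
move=> ha hb x; rewrite rmorphM /= ha hb -scalerAl -scalerAr scalerA.
by rewrite -!chiV dual_mul.
Qed.

Lemma homogZ g c a : homog g a -> homog g (c *: a).
Proof. by move=> ha x; rewrite linearZ /= ha !scalerA mulrC. Qed.

Fact comp_is_linear g : linear (hcomp g).
Proof.
move=> c a b; rewrite /hcomp scalerA [c * _]mulrC -scalerA -scalerDr.
congr (_ *: _); rewrite scaler_sumr -big_split; apply: eq_bigr => x _ /=.
by rewrite linearP scalerDr !scalerA mulrC.
Qed.
HB.instance Definition _ g :=
  GRing.isLinear.Build k A A *:%R (hcomp g) (comp_is_linear g).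

End Grading.

Section Twist.
Variables (k : fieldType) (G : finGroupType) (A : algType k).
Variables (chi : dual_iso k G) (mu : cocycle2 k G) (rho : alg_action G A).

Local Notation hcomp := (hcomp chi rho).

(* The bilinear extension of a *_mu b = mu(g, h) a b, for a in A_g and   *)
(* b in A_h; see [twist_mul_homog].                                      *)
Definition twist_mul (a b : A) : A :=
  \sum_g \sum_h mu g h *: (hcomp g a * hcomp h b).

Lemma twist_mul_homog g h a b : homog chi rho g a -> homog chi rho h b ->
  twist_mul a b = mu g h *: (a * b).
Proof.
move=> ha hb; rewrite /twist_mul (bigD1 g) //= (bigD1 h) //=.
rewrite (comp_id ha) (comp_id hb) big1 ?addr0 => [|l nl]; last first.
  by rewrite (comp_neq hb nl) mulr0 scaler0.
rewrite big1 ?addr0 // => l nl; apply: big1 => m _.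
by rewrite (comp_neq ha nl) mul0r scaler0.
Qed.

Let compZ g c a : hcomp g (c *: a) = c *: hcomp g a.
Proof. exact: linearZ. Qed.

Let compD g : {morph hcomp g : a b / a + b}.
Proof. exact: linearD. Qed.

Lemma twist_mulDl : left_distributive twist_mul +%R.
Proof.
move=> a b c; rewrite /twist_mul -big_split; apply: eq_bigr => g _ /=.
rewrite -big_split; apply: eq_bigr => h _ /=.
by rewrite compD mulrDl scalerDr.
Qed.

Lemma twist_mulDr : right_distributive twist_mul +%R.
Proof.
move=> a b c; rewrite /twist_mul -big_split; apply: eq_bigr => g _ /=.
rewrite -big_split; apply: eq_bigr => h _ /=.
by rewrite compD mulrDr scalerDr.
Qed.

Lemma twist_scaleAl c a b : c *: twist_mul a b = twist_mul (c *: a) b.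
Proof.
rewrite /twist_mul scaler_sumr; apply: eq_bigr => g _.
rewrite scaler_sumr; apply: eq_bigr => h _.
by rewrite compZ -[in RHS]scalerAl !scalerA mulrC.
Qed.

Lemma twist_scaleAr c a b : c *: twist_mul a b = twist_mul a (c *: b).
Proof.
rewrite /twist_mul scaler_sumr; apply: eq_bigr => g _.
rewrite scaler_sumr; apply: eq_bigr => h _.
by rewrite compZ -[in RHS]scalerAr !scalerA mulrC.
Qed.

Lemma twist_mul_suml (I : finType) (F : I -> A) b :
  twist_mul (\sum_i F i) b = \sum_i twist_mul (F i) b.
Proof.
have m0 : twist_mul 0 b = 0 by have := twist_scaleAl 0 0 b; rewrite !scale0r.
exact: (big_morph (twist_mul^~ b) (fun x y => twist_mulDl x y b) m0).
Qed.

Lemma twist_mul_sumr (I : finType) (F : I -> A) a :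
  twist_mul a (\sum_i F i) = \sum_i twist_mul a (F i).
Proof.
have m0 : twist_mul a 0 = 0 by have := twist_scaleAr 0 a 0; rewrite !scale0r.
exact: (big_morph (twist_mul a) (twist_mulDr a) m0).
Qed.

Lemma twist_mulA : associative twist_mul.
Proof.
move=> a b c; rewrite -(sum_comp chi rho a) -(sum_comp chi rho b).
rewrite -(sum_comp chi rho c) !twist_mul_suml; apply: eq_bigr => g _.
rewrite twist_mul_sumr (twist_mul_sumr _ (hcomp g a)) twist_mul_suml.
apply: eq_bigr => h _; rewrite !twist_mul_sumr; apply: eq_bigr => l _.
have hg := homog_comp chi rho g a; have hh := homog_comp chi rho h b.
have hl := homog_comp chi rho l c.
rewrite (twist_mul_homog hg hh) (twist_mul_homog hh hl).
rewrite -(twist_scaleAl _ (hcomp g a * _)) -(twist_scaleAr _ _ (hcomp h b * _)).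
rewrite (twist_mul_homog hg (homogM hh hl)).
rewrite (twist_mul_homog (homogM hg hh) hl) !scalerA mulrA.
by rewrite cocycleA [in LHS]mulrC.
Qed.

Lemma twist_mul1r : left_id 1 twist_mul.
Proof.
move=> a; rewrite -{2}(sum_comp chi rho a) -{1}(sum_comp chi rho a).
rewrite twist_mul_sumr; apply: eq_bigr => g _.
rewrite (twist_mul_homog (homog1 chi rho) (homog_comp chi rho g a)).
by rewrite cocycle1g scale1r mul1r.
Qed.

Lemma twist_mulr1 : right_id 1 twist_mul.
Proof.
move=> a; rewrite -{2}(sum_comp chi rho a) -{1}(sum_comp chi rho a).
rewrite twist_mul_suml; apply: eq_bigr => g _.
rewrite (twist_mul_homog (homog_comp chi rho g a) (homog1 chi rho)).
by rewrite cocycleg1 scale1r mulr1.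
Qed.

(* The algebra A^{G,mu}; the arguments of the alias only serve to select *)
(* the product [twist_mul chi mu rho].                                   *)
Definition twist (c : dual_iso k G) (m : cocycle2 k G)
  (r : alg_action G A) : Type := A.
Local Notation tw := (twist chi mu rho).

HB.instance Definition _ := GRing.Lmodule.copy tw A.
HB.instance Definition _ := GRing.Zmodule_isNzRing.Build tw
  twist_mulA twist_mul1r twist_mulr1 twist_mulDl twist_mulDr (oner_neq0 A).
HB.instance Definition _ := GRing.Lmodule_isLalgebra.Build k tw
  twist_scaleAl.
HB.instance Definition _ := GRing.Lalgebra_isAlgebra.Build k tw
  twist_scaleAr.

Lemma twistM (a b : tw) : a * b = twist_mul a b.
Proof. by []. Qed.

End Twist.

(* -------------------------------------------------------------------- *)
(* Algebras presented by generators and relations                       *)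
(* -------------------------------------------------------------------- *)

Inductive ideal_gen (R : nzRingType) (S : seq R) : R -> Prop :=
| IdealGen0 : ideal_gen S 0
| IdealGenIn r : r \in S -> ideal_gen S r
| IdealGenD x y : ideal_gen S x -> ideal_gen S y -> ideal_gen S (x + y)
| IdealGenMl a x : ideal_gen S x -> ideal_gen S (a * x)
| IdealGenMr a x : ideal_gen S x -> ideal_gen S (x * a).

(* The free algebra on X_0, ..., X_(n-1), as the algebra of words.       *)
Definition free_alg (k : fieldType) (n : nat) : Type :=
  {malg k[{fmonom 'I_n}]}.

Section FreeAlg.
Variables (k : fieldType) (n : nat).

HB.instance Definition _ := GRing.Lalgebra.on (free_alg k n).

Fact free_scaleAr (c : k) (x y : free_alg k n) : c *: (x * y) = x * (c *: y).
Proof.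
apply/malgP=> m; rewrite mcoeffZ (mcoeffMlw _ (fsubset_refl _) (fsubset_refl _)).
rewrite (mcoeffMlw _ (fsubset_refl _) (msuppZ_le _ _)) mulr_sumr.
apply: eq_bigr => k1 _; rewrite mulr_sumr; apply: eq_bigr => k2 _.
by rewrite mcoeffZ mulrnAr mulrCA.
Qed.
HB.instance Definition _ :=
  GRing.Lalgebra_isAlgebra.Build k (free_alg k n) free_scaleAr.

Definition free_var (i : 'I_n) : free_alg k n := << fmu i >>.

Definition const_coef (x : free_alg k n) : k := @mcoeff {fmonom 'I_n} k mone x.

HB.instance Definition _ := GRing.RMorphism.copy const_coef
  (@mcoeff {fmonom 'I_n} k mone).

Lemma const_coef_var i : const_coef (free_var i) = 0.
Proof.
rewrite /const_coef /free_var mcoeffU; case: eqP => // /(congr1 val) /=.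
by rewrite fm1 fmU.
Qed.

Lemma const_coefZ c x : const_coef (c *: x) = c * const_coef x.
Proof. exact: mcoeffZ. Qed.

End FreeAlg.

(* Relators without constant term: the quotient is then a nonzero ring,  *)
(* as [algType] requires.                                                *)
Record presentation (k : fieldType) (n : nat) := Presentation {
  relators :> seq (free_alg k n);
  relators_const : all (fun r => const_coef r == 0) relators
}.

Section Presented.
Variables (k : fieldType) (n : nat) (P : presentation k n).

Local Notation F := (free_alg k n).

Definition rel_ideal : {pred F} := fun x => `[< ideal_gen P x >].

Lemma rel_idealP x : reflect (ideal_gen P x) (x \in rel_ideal).
Proof. exact: asboolP. Qed.

Fact rel_ideal_zmod : zmod_closed rel_ideal.
Proof.
split=> [|x y /rel_idealP hx /rel_idealP hy]; apply/rel_idealP.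
  exact: IdealGen0.
by apply: IdealGenD => //; rewrite -mulN1r; apply: IdealGenMl.
Qed.
HB.instance Definition _ := GRing.isZmodClosed.Build F rel_ideal rel_ideal_zmod.

(* k<X_0, ..., X_(n-1)> / (P)                                            *)
Definition presented : Type := Quotient.quot rel_ideal.

HB.instance Definition _ := GRing.Zmodule.on presented.

Definition pres_pi (x : F) : presented := \pi_(Quotient.quot rel_ideal)%qT x.
Definition pres_repr (x : presented) : F :=
  repr (x : Quotient.quot rel_ideal).

Lemma pres_reprK x : pres_pi (pres_repr x) = x.
Proof. exact: reprK. Qed.

Lemma pres_piP x y : reflect (pres_pi x = pres_pi y) (x - y \in rel_ideal).
Proof. by rewrite Quotient.idealrBE; apply: eqP. Qed.

Lemma pres_piD x y : pres_pi (x + y) = pres_pi x + pres_pi y.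
Proof. exact: Quotient.pi_add. Qed.

Lemma pres_pi0 : pres_pi 0 = 0.
Proof. by apply: (addrI (pres_pi 0)); rewrite -pres_piD !addr0. Qed.

Lemma pres_pi0P x : reflect (pres_pi x = 0) (x \in rel_ideal).
Proof. by rewrite -[x in x \in _]subr0 -pres_pi0; apply: pres_piP. Qed.

Definition pres_one : presented := pres_pi 1.
Definition pres_mul (x y : presented) : presented :=
  pres_pi (pres_repr x * pres_repr y).
Definition pres_scale (c : k) (x : presented) : presented :=
  pres_pi (c *: pres_repr x).

Lemma pres_repr_pi x : x - pres_repr (pres_pi x) \in rel_ideal.
Proof. by apply/pres_piP; rewrite pres_reprK. Qed.

Lemma pres_piM x y : pres_pi (x * y) = pres_mul (pres_pi x) (pres_pi y).
Proof.
apply/pres_piP; set x' := pres_repr _; set y' := pres_repr _.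
have -> : x * y - x' * y' = (x - x') * y + x' * (y - y').
  by rewrite mulrBl mulrBr addrA subrK.
apply/rel_idealP/IdealGenD.
  by apply/IdealGenMr/rel_idealP/pres_repr_pi.
by apply/IdealGenMl/rel_idealP/pres_repr_pi.
Qed.

Lemma pres_piZ c x : pres_pi (c *: x) = pres_scale c (pres_pi x).
Proof.
apply/pres_piP; rewrite -scalerBr -mulr_algl.
by apply/rel_idealP/IdealGenMl/rel_idealP/pres_repr_pi.
Qed.

Lemma pres_ind (Q : presented -> Prop) : (forall x, Q (pres_pi x)) -> forall x, Q x.
Proof. by move=> h x; rewrite -(pres_reprK x). Qed.

Lemma ideal_const x : ideal_gen P x -> const_coef x = 0.
Proof.
elim=> [|r rP|y z _ hy _ hz|a y _ hy|a y _ hy].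
- by rewrite raddf0.
- exact/eqP/(allP (relators_const P)).
- by rewrite raddfD /= hy hz addr0.
- by rewrite rmorphM /= hy mulr0.
- by rewrite rmorphM /= hy mul0r.
Qed.

Fact pres_mulA : associative pres_mul.
Proof.
by elim/pres_ind=> x; elim/pres_ind=> y; elim/pres_ind=> z;
  rewrite -!pres_piM mulrA.
Qed.

Fact pres_mul1r : left_id pres_one pres_mul.
Proof. by elim/pres_ind=> x; rewrite -pres_piM mul1r. Qed.

Fact pres_mulr1 : right_id pres_one pres_mul.
Proof. by elim/pres_ind=> x; rewrite -pres_piM mulr1. Qed.

Fact pres_mulDl : left_distributive pres_mul +%R.
Proof.
by elim/pres_ind=> x; elim/pres_ind=> y; elim/pres_ind=> z;
  rewrite -!pres_piM -!pres_piD -pres_piM mulrDl.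
Qed.

Fact pres_mulDr : right_distributive pres_mul +%R.
Proof.
by elim/pres_ind=> x; elim/pres_ind=> y; elim/pres_ind=> z;
  rewrite -!pres_piM -!pres_piD -pres_piM mulrDr.
Qed.

Fact pres_one_neq0 : pres_one != 0.
Proof.
apply/eqP => /pres_pi0P/rel_idealP/ideal_const/eqP.
by rewrite rmorph1 oner_eq0.
Qed.

HB.instance Definition _ := GRing.Zmodule_isNzRing.Build presented
  pres_mulA pres_mul1r pres_mulr1 pres_mulDl pres_mulDr pres_one_neq0.

Fact pres_scaleA a b x : pres_scale a (pres_scale b x) = pres_scale (a * b) x.
Proof. by elim/pres_ind: x => x; rewrite -!pres_piZ scalerA. Qed.

Fact pres_scale1r : left_id 1 pres_scale.
Proof. by elim/pres_ind=> x; rewrite -pres_piZ scale1r. Qed.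

Fact pres_scaleDr : right_distributive pres_scale +%R.
Proof.
by move=> a; elim/pres_ind=> x; elim/pres_ind=> y;
  rewrite -!pres_piZ -!pres_piD -pres_piZ scalerDr.
Qed.

Fact pres_scaleDl x : {morph pres_scale^~ x : a b / a + b}.
Proof.
by move=> a b; elim/pres_ind: x => x; rewrite -!pres_piZ -pres_piD scalerDl.
Qed.

HB.instance Definition _ := GRing.Zmodule_isLmodule.Build k presented
  pres_scaleA pres_scale1r pres_scaleDr pres_scaleDl.

Fact pres_scaleAl (a : k) (x y : presented) : a *: (x * y) = (a *: x) * y.
Proof.
elim/pres_ind: x => x; elim/pres_ind: y => y.
change (pres_scale a (pres_mul (pres_pi x) (pres_pi y)) =
        pres_mul (pres_scale a (pres_pi x)) (pres_pi y)).
by rewrite -!(pres_piM, pres_piZ) scalerAl.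
Qed.

HB.instance Definition _ := GRing.Lmodule_isLalgebra.Build k presented
  pres_scaleAl.

Fact pres_scaleAr (a : k) (x y : presented) : a *: (x * y) = x * (a *: y).
Proof.
elim/pres_ind: x => x; elim/pres_ind: y => y.
change (pres_scale a (pres_mul (pres_pi x) (pres_pi y)) =
        pres_mul (pres_pi x) (pres_scale a (pres_pi y))).
by rewrite -!(pres_piM, pres_piZ) scalerAr.
Qed.

HB.instance Definition _ := GRing.Lalgebra_isAlgebra.Build k presented
  pres_scaleAr.

Fact pres_pi_linear : linear pres_pi.
Proof. by move=> a x y; rewrite pres_piD pres_piZ. Qed.
Fact pres_pi_monoid : monoid_morphism pres_pi.
Proof. by split=> // x y; rewrite pres_piM. Qed.

HB.instance Definition _ :=
  GRing.isLinear.Build k F presented *:%R pres_pi pres_pi_linear.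
HB.instance Definition _ :=
  GRing.isMonoidMorphism.Build F presented pres_pi pres_pi_monoid.

Definition gen (i : 'I_n) : presented := pres_pi (free_var k i).

End Presented.

Section Lift.
Variables (k : fieldType) (n : nat) (B : algType k) (y : 'I_n -> B).

Local Notation F := (free_alg k n).

Definition word_eval (m : {fmonom 'I_n}) : B := \prod_(i <- m) y i.

Fact word_eval_morph : mmorphism word_eval.
Proof.
split=> [m1 m2|]; rewrite /word_eval; first by rewrite fmM big_cat.
by rewrite fm1 big_nil.
Qed.
HB.instance Definition _ :=
  monalg.isMultiplicative.Build {fmonom 'I_n} B word_eval word_eval_morph.

Definition free_eval (x : F) : B :=
  @mmap {fmonom 'I_n} k B (GRing.in_alg B) word_eval x.

Fact free_eval_zmod : zmod_morphism free_eval.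
Proof. exact: mmap_is_additive. Qed.
HB.instance Definition _ :=
  GRing.isZmodMorphism.Build F B free_eval free_eval_zmod.

Fact free_eval_monoid : monoid_morphism free_eval.
Proof.
have c : forall (g : {malg k[{fmonom 'I_n}]}) m m',
    GRing.comm (GRing.in_alg B (mcoeff m g)) (word_eval m').
  by move=> g m m'; rewrite /GRing.comm /= mulr_algl mulr_algr.
by have [hM h1] := commr_mmap_is_multiplicative c; split.
Qed.
HB.instance Definition _ :=
  GRing.isMonoidMorphism.Build F B free_eval free_eval_monoid.

Fact free_eval_scalable : scalable free_eval.
Proof.
by move=> c x; rewrite /free_eval (@mmapZ _ _ _ (GRing.in_alg B)) /= mulr_algl.
Qed.
HB.instance Definition _ :=
  GRing.isScalable.Build k F B *:%R free_eval free_eval_scalable.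

Lemma free_eval_var i : free_eval (free_var k i) = y i.
Proof.
by rewrite /free_eval mmapU /= scale1r mul1r /word_eval fmU big_seq1.
Qed.

Variable P : presentation k n.

(* Universal property of the presented algebra.                          *)
Lemma presented_lift : all (fun r => free_eval r == 0) P ->
  exists f : {lrmorphism presented P -> B}, forall i, f (gen P i) = y i.
Proof.
move=> /allP hP.
have h0 x : ideal_gen P x -> free_eval x = 0.
  elim=> [|r rP|a b _ ha _ hb|a b _ hb|a b _ hb].
  - by rewrite raddf0.
  - exact/eqP/hP.
  - by rewrite raddfD /= ha hb addr0.
  - by rewrite rmorphM /= hb mulr0.
  - by rewrite rmorphM /= hb mul0r.
pose f (x : presented P) := free_eval (pres_repr x).
have fE x : f (pres_pi P x) = free_eval x.
  apply/esym/eqP; rewrite -subr_eq0 -raddfB; apply/eqP/h0.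
  exact/rel_idealP/pres_repr_pi.
have fL : linear f.
  move=> a; elim/pres_ind=> x; elim/pres_ind=> z.
  by rewrite -linearP !fE linearP.
have fM : monoid_morphism f.
  split; first by rewrite fE rmorph1.
  by elim/pres_ind=> x; elim/pres_ind=> z; rewrite -rmorphM !fE rmorphM.
pose fl := GRing.isLinear.Build k (presented P) B *:%R f fL.
pose fm := GRing.isMonoidMorphism.Build (presented P) B f fM.
pose g : {lrmorphism presented P -> B} := HB.pack f fl fm.
by exists g => i; rewrite /= fE free_eval_var.
Qed.

End Lift.

Section Generators.
Variables (k : fieldType) (n : nat).

Lemma free_alg_words (x : free_alg k n) :
  x = \sum_(m <- @msupp {fmonom 'I_n} k x)
        @mcoeff {fmonom 'I_n} k m x *: \prod_(i <- m) free_var k i.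
Proof.
rewrite {1}[x](@monalgE {fmonom 'I_n} k); apply: eq_bigr => m _.
have -> : \prod_(i <- m) free_var k i = << m >> :> {malg k[{fmonom 'I_n}]}.
  case: m => s /=; elim: s => [|i s ih].
    rewrite big_nil (_ : FMonom [::] = mone) //.
    by apply/val_inj; rewrite /= fm1.
  rewrite big_cons ih (_ : FMonom (i :: s) = mmul (fmu i) (FMonom s)).
    by rewrite -[LHS]/(fgmul _ _) fgmulUU mulr1.
  by apply: val_inj; rewrite [RHS]fmM fmU.
by apply/malgP => m'; rewrite mcoeffZ !mcoeffU mulrnAr mulr1.
Qed.

Lemma presented_ext (P : presentation k n) (B : algType k)
    (f g : {lrmorphism presented P -> B}) :
  (forall i, f (gen P i) = g (gen P i)) -> f =1 g.
Proof.
move=> fg; elim/pres_ind => x; rewrite (free_alg_words x) !raddf_sum /=.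
apply: eq_bigr => m _; rewrite !linearZ /= !rmorph_prod /=; congr (_ *: _).
by apply: eq_bigr => i _; apply: fg.
Qed.

End Generators.

(* -------------------------------------------------------------------- *)
(* The group (C_2)^2, its duality and its 2-cocycle                     *)
(* -------------------------------------------------------------------- *)

(* The pair (p, q) of residues mod 2 is the element g_1^p g_2^q.         *)
Definition klein : finGroupType := ('Z_2 * 'Z_2)%type.
Definition g1 : klein := (1, 0).
Definition g2 : klein := (0, 1).

Lemma klein_cases (g : klein) : [\/ g = 1%g, g = g1, g = g2 | g = (g1 * g2)%g].
Proof.
by case: g => [[[|[|//]] hp] [[|[|//]] hq]];
  [apply: Or41 | apply: Or43 | apply: Or42 | apply: Or44];
  congr pair; apply: val_inj.
Qed.

Section Klein.
Variable k : fieldType.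

Definition klein_chi (g h : klein) : k :=
  if (g == 1%g) || (h \in [:: 1%g; g]) then 1 else - 1.

Definition klein_mu (g h : klein) : k := (- 1) ^+ (g.1 * h.2)%N.

Fact klein_mu_neq0 g h : klein_mu g h != 0.
Proof. by rewrite expf_neq0 ?oppr_eq0 ?oner_neq0. Qed.

Fact klein_muA g h l : klein_mu g h * klein_mu (g * h)%g l =
  klein_mu g (h * l)%g * klein_mu h l.
Proof.
rewrite /klein_mu -!exprD -signr_odd -[RHS]signr_odd; congr (_ ^+ _).
by case: (klein_cases g) => ->; case: (klein_cases h) => ->;
  case: (klein_cases l) => ->.
Qed.

Fact klein_mu1g g : klein_mu 1%g g = 1.
Proof. by []. Qed.

Fact klein_mug1 g : klein_mu g 1%g = 1.
Proof. by rewrite /klein_mu muln0. Qed.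

Definition klein_cocycle : cocycle2 k klein :=
  Cocycle2 klein_mu_neq0 klein_muA klein_mu1g klein_mug1.

Hypothesis char0 : [pchar k] =i pred0.

Fact klein_two_neq0 : 2 != 0 :> k.
Proof. by have := char0 2; rewrite inE /= => ->. Qed.

Fact klein_N1_neq1 : - 1 != 1 :> k.
Proof. by rewrite eq_sym -subr_eq0 opprK klein_two_neq0. Qed.

Fact klein_chi1 g : klein_chi g 1%g = 1.
Proof. by rewrite /klein_chi inE eqxx orbT. Qed.

Fact klein_chiM g x y : klein_chi g (x * y)%g = klein_chi g x * klein_chi g y.
Proof.
by rewrite /klein_chi; case: (klein_cases g) => ->; case: (klein_cases x) => ->;
  case: (klein_cases y) => ->; rewrite /= ?(mul1r, mulr1, mulrNN).
Qed.

Fact klein_chi_mul g h x :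
  klein_chi (g * h)%g x = klein_chi g x * klein_chi h x.
Proof.
by rewrite /klein_chi; case: (klein_cases g) => ->; case: (klein_cases h) => ->;
  case: (klein_cases x) => ->; rewrite /= ?(mul1r, mulr1, mulrNN).
Qed.

Fact klein_chi_inj g h : (forall x, klein_chi g x = klein_chi h x) -> g = h.
Proof.
move=> e; pose b (g h : klein) := (g == 1%g) || (h \in [:: 1%g; g]).
have eb x : b g x = b h x.
  move: (e x); rewrite /klein_chi -/(b g x) -/(b h x).
  case: (b g x) (b h x) => [] [] // /esym/eqP.
    by rewrite (negPf klein_N1_neq1).
  by rewrite eq_sym (negPf klein_N1_neq1).
move: (eb g1) (eb g2); rewrite {eb e}/b.
by case: (klein_cases g) => ->; case: (klein_cases h) => ->.
Qed.

Fact klein_chi_surj (f : klein -> k) :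
  f 1%g = 1 -> (forall x y, f (x * y)%g = f x * f y) ->
  exists g, forall x, f x = klein_chi g x.
Proof.
move=> f1 fM.
have sq x : (f x == 1) || (f x == - 1).
  rewrite -eqf_sqr expr1n expr2 -fM -f1; apply/eqP; congr f.
  by case: (klein_cases x) => ->; apply/eqP.
have fg : f (g1 * g2)%g = f g1 * f g2 by apply: fM.
case/orP: (sq g1) => /eqP a; case/orP: (sq g2) => /eqP b; rewrite a b in fg;
  [exists 1%g | exists g1 | exists g2 | exists (g1 * g2)%g] => x;
  by case: (klein_cases x) => ->; rewrite ?f1 ?a ?b ?fg /klein_chi /=
    ?(mul1r, mulr1, mulrNN).
Qed.

Fact klein_order : #|klein|%:R != 0 :> k.
Proof.
rewrite (_ : #|klein| = (2 * 2)%N); last by rewrite card_prod card_ord.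
by rewrite natrM mulf_neq0 ?klein_two_neq0.
Qed.

Definition klein_dual : dual_iso k klein :=
  DualIso klein_chi1 klein_chiM klein_chi_mul klein_chi_inj klein_chi_surj
    klein_order.

End Klein.

(* -------------------------------------------------------------------- *)
(* The algebras                                                         *)
(* -------------------------------------------------------------------- *)

Definition bracket (R : nzRingType) (x y : R) : R := x * y - y * x.
Definition anticomm (R : nzRingType) (x y : R) : R := x * y + y * x.

Section Relators.
Variables (k : fieldType) (B : algType k) (w1 w2 w3 : B).

Definition rel_A : seq B :=
  [:: w1 ^+ 2 - w2 ^+ 2; w3 * w1 - w1 * w3; w3 ^+ 2 * w2 - w2 * w3 ^+ 2;
      bracket w3 (anticomm w1 w2)].

Definition rel_B : seq B :=
  [:: w1 ^+ 2 - w2 ^+ 2; w3 * w1 - w1 * w3; w3 ^+ 2 * w2 - w2 * w3 ^+ 2;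
      anticomm w3 (bracket w2 w1)].

Definition rel_C : seq B :=
  [:: w1 ^+ 2 - w2 ^+ 2; w3 * w1 - w1 * w3; w3 ^+ 2 * w2 - w2 * w3 ^+ 2;
      bracket w3 (bracket w1 w2)].

Definition rel_D : seq B :=
  [:: w1 ^+ 2 - w2 ^+ 2; w3 * w1 - w1 * w3; w3 ^+ 2 * w2 - w2 * w3 ^+ 2;
      anticomm w3 (anticomm w1 w2)].

Definition rel_E (gamma : k) : seq B :=
  [:: w1 ^+ 2 - w2 ^+ 2; w3 * w1 - w1 * w3; w3 ^+ 2 * w2 + w2 * w3 ^+ 2;
      w3 * w2 * w1 - w1 * w3 * w2
        + gamma *: (w1 * w2 * w3) - gamma *: (w2 * w1 * w3)].

(* For gamma = (1 + i)/2, resp. (1 - i)/2, the coefficient 2 gamma - 1   *)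
(* is i, resp. - i.                                                      *)
Definition rel_G (gamma : k) : seq B :=
  let c := 2 * gamma - 1 in
  [:: w1 ^+ 2 - w2 ^+ 2; w3 * w1 - w1 * w3; w3 ^+ 2 * w2 + w2 * w3 ^+ 2;
      w3 * w1 * w2 + w3 * w2 * w1
        + c *: (w1 * w2 * w3) + c *: (w2 * w1 * w3)].

End Relators.

Lemma allP4 (T : Type) (p : pred T) a b c d :
  [&& p a, p b, p c & p d] -> all p [:: a; b; c; d].
Proof. by rewrite /= andbT. Qed.

Section ConstRelators.
Variables (k : fieldType) (B : algType k) (f : {rmorphism B -> k}).
Hypothesis fZ : forall c x, f (c *: x) = c * f x.
Variables (w1 w2 w3 : B).
Hypothesis fw : (f w1 = 0) * (f w2 = 0) * (f w3 = 0).

Let simp := (raddfB, raddfD, rmorphM, fZ, fw,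
  mul0r, mulr0, addr0, subr0, eqxx).

Fact const_A : all (fun r => f r == 0) (rel_A w1 w2 w3).
Proof. by apply: allP4; rewrite /bracket /anticomm !expr2 !simp /= !simp. Qed.
Fact const_B : all (fun r => f r == 0) (rel_B w1 w2 w3).
Proof. by apply: allP4; rewrite /bracket /anticomm !expr2 !simp /= !simp. Qed.
Fact const_C : all (fun r => f r == 0) (rel_C w1 w2 w3).
Proof. by apply: allP4; rewrite /bracket /anticomm !expr2 !simp /= !simp. Qed.
Fact const_D : all (fun r => f r == 0) (rel_D w1 w2 w3).
Proof. by apply: allP4; rewrite /bracket /anticomm !expr2 !simp /= !simp. Qed.
Fact const_E gamma :
  all (fun r => f r == 0) (rel_E w1 w2 w3 gamma).
Proof. by apply: allP4; rewrite !expr2 !simp /= !simp. Qed.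
Fact const_G gamma :
  all (fun r => f r == 0) (rel_G w1 w2 w3 gamma).
Proof. by apply: allP4; rewrite !expr2 !simp /= !simp. Qed.

End ConstRelators.

Section Algebras.
Variable k : fieldType.

Let X1 : free_alg k 3 := free_var k 0.
Let X2 : free_alg k 3 := free_var k 1.
Let X3 : free_alg k 3 := free_var k 2.
Let W1 : free_alg k 3 := X1 + X2.
Let W2 : free_alg k 3 := X1 - X2.
Let W3 : free_alg k 3 := X3.

Let constW : (const_coef W1 = 0) * (const_coef W2 = 0) * (const_coef W3 = 0).
Proof.
have e1 := const_coef_var k (0 : 'I_3); have e2 := const_coef_var k (1 : 'I_3).
split; [split|exact: const_coef_var].
  have -> : const_coef W1 = const_coef X1 + const_coef X2.
    exact: (raddfD (@const_coef k 3)).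
  by rewrite e1 e2 addr0.
have -> : const_coef W2 = const_coef X1 - const_coef X2.
  exact: (raddfB (@const_coef k 3)).
by rewrite e1 e2 subr0.
Qed.

(* A(1,-1), B(1), C(1), D(1,1), E(1,gamma) and G(1,gamma).               *)
Definition pres_A : presentation k 3 := Presentation (const_A constW).
Definition pres_B : presentation k 3 := Presentation (const_B constW).
Definition pres_C : presentation k 3 := Presentation (const_C constW).
Definition pres_D : presentation k 3 := Presentation (const_D constW).
Definition pres_E (gamma : k) : presentation k 3 :=
  Presentation (const_E (@const_coefZ k 3) constW gamma).
Definition pres_G (gamma : k) : presentation k 3 :=
  Presentation (const_G (@const_coefZ k 3) constW gamma).

Definition x1 (P : presentation k 3) : presented P := gen P 0.
Definition x2 (P : presentation k 3) : presented P := gen P 1.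
Definition x3 (P : presentation k 3) : presented P := gen P 2.

Definition swap_action (P : presentation k 3)
    (rho : alg_action klein (presented P)) : Prop :=
  [/\ rho g1 (x1 P) = x2 P, rho g1 (x2 P) = x1 P & rho g1 (x3 P) = x3 P] /\
  [/\ rho g2 (x1 P) = x1 P, rho g2 (x2 P) = x2 P & rho g2 (x3 P) = - x3 P].

End Algebras.

(* The actions in question exist: [swap_action] is satisfiable for the   *)
(* algebras A(1,-1), B(1), E(1,gamma) and G(1,gamma).                    *)

Section SwapAction.
Variable k : fieldType.

Definition word_family := forall B : algType k, B -> B -> B -> seq B.

Definition natural_family (R : word_family) : Prop :=
  forall (B B' : algType k) (f : {lrmorphism B -> B'}) w1 w2 w3,
  map f (R B w1 w2 w3) = R B' (f w1) (f w2) (f w3).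

Definition sign_family (R : word_family) : Prop :=
  forall (B : algType k) (w1 w2 w3 : B) (b c : bool),
  all (fun r => r == 0) (R B w1 w2 w3) ->
  all (fun r => r == 0) (R B w1 ((-1) ^+ b * w2) ((-1) ^+ c * w3)).

Lemma I3_cases (i : 'I_3) : [\/ i = 0, i = 1 | i = 2].
Proof.
by case: i => [[|[|[|//]]] h]; [apply: Or31 | apply: Or32 | apply: Or33];
  apply: val_inj.
Qed.

Lemma swap_action_exists (R : word_family) (P : presentation k 3) :
  natural_family R -> sign_family R ->
  relators P = R (free_alg k 3) (free_var k 0 + free_var k 1)
    (free_var k 0 - free_var k 1) (free_var k 2) ->
  exists rho : alg_action klein (presented P), swap_action rho.
Proof.
move=> Rnat Rsign eP.
pose y (b c : bool) (i : 'I_3) : presented P :=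
  if i == 0 then (if b then x2 P else x1 P)
  else if i == 1 then (if b then x1 P else x2 P) else (-1) ^+ c * x3 P.
have R0 : all (fun r => r == 0) (R (presented P) (x1 P + x2 P)
                                   (x1 P - x2 P) (x3 P)).
  have -> : R (presented P) (x1 P + x2 P) (x1 P - x2 P) (x3 P) =
            map (@pres_pi k 3 P) (relators P).
    pose F : {lrmorphism free_alg k 3 -> presented P} := @pres_pi k 3 P.
    rewrite eP (Rnat _ _ F); congr (R _ _ _ _).
      by apply: esym; exact: (raddfD F).
    by apply: esym; exact: (raddfB F).
  rewrite all_map; apply/allP => r rP /=; apply/eqP/pres_pi0P/rel_idealP.
  exact: IdealGenIn.
have lift b c : exists f : {lrmorphism presented P -> presented P},
    forall i, f (gen P i) = y b c i.
  apply: presented_lift; pose F : {lrmorphism free_alg k 3 -> presented P} := free_eval (y b c).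
  suff : all (fun r => r == 0) (map F (relators P)) by rewrite all_map.
  rewrite eP (Rnat _ _ F).
  have F0 : F (free_var k 0) = if b then x2 P else x1 P.
    exact: free_eval_var.
  have F1 : F (free_var k 1) = if b then x1 P else x2 P.
    exact: free_eval_var.
  have F2 : F (free_var k 2) = (-1) ^+ c * x3 P by exact: free_eval_var.
  have -> : F (free_var k 0 + free_var k 1) = x1 P + x2 P.
    have -> : F (free_var k 0 + free_var k 1) =
       F (free_var k 0) + F (free_var k 1) by exact: (raddfD F).
    by rewrite F0 F1; case: b {F F0 F1 F2} => //; rewrite addrC.
  have -> : F (free_var k 0 - free_var k 1) = (-1) ^+ b * (x1 P - x2 P).
    have -> : F (free_var k 0 - free_var k 1) =
       F (free_var k 0) - F (free_var k 1) by exact: (raddfB F).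
    by rewrite F0 F1; case: b {F F0 F1 F2};
      rewrite ?expr1 ?expr0 ?mulN1r ?mul1r ?opprB.
  by rewrite F2; apply: Rsign.
pose s (g : klein) := g.1 != 0; pose t (g : klein) := g.2 != 0.
have sM g h : s (g * h)%g = s g (+) s h.
  by rewrite /s; case: (klein_cases g) => ->; case: (klein_cases h) => ->.
have tM g h : t (g * h)%g = t g (+) t h.
  by rewrite /t; case: (klein_cases g) => ->; case: (klein_cases h) => ->.
have [f fE] := choice (fun g => lift (s g) (t g)).
have fx1 g : f g (x1 P) = if s g then x2 P else x1 P by rewrite fE.
have fx2 g : f g (x2 P) = if s g then x1 P else x2 P by rewrite fE.
have fx3 g : f g (x3 P) = (-1) ^+ t g * x3 P by rewrite fE.
have [sg1 sg2] : s g1 = true /\ s g2 = false by [].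
have [tg1 tg2] : t g1 = false /\ t g2 = true by [].
clear R0 lift fE y; clearbody s t.
have s1 : s 1%g = false by rewrite -(mulg1 1%g) sM addbb.
have t1 : t 1%g = false by rewrite -(mulg1 1%g) tM addbb.
have f1 a : f 1%g a = a.
  pose idm : {lrmorphism presented P -> presented P} := idfun.
  apply: (presented_ext (g := idm)) => i.
  by case: (I3_cases i) => ->; rewrite ?fx1 ?fx2 ?fx3 ?s1 ?t1 ?expr0 ?mul1r.
have fM g h a : f (g * h)%g a = f h (f g a).
  pose cm : {lrmorphism presented P -> presented P} := f h \o f g.
  apply: (presented_ext (g := cm)) => i; case: (I3_cases i) => ->.
  - rewrite fx1 sM -[cm _]/(f h (f g (x1 P))) fx1.
    by case: (s g); rewrite ?fx1 ?fx2; case: (s h).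
  - rewrite fx2 sM -[cm _]/(f h (f g (x2 P))) fx2.
    by case: (s g); rewrite ?fx1 ?fx2; case: (s h).
  - rewrite fx3 tM -[cm _]/(f h (f g (x3 P))) fx3 rmorphM rmorph_sign /= fx3.
    by rewrite mulrA signr_addb.
exists (AlgAction f1 fM); rewrite /swap_action /=.
have x3g1 : f g1 (x3 P) = x3 P by rewrite fx3 tg1 expr0 mul1r.
have x3g2 : f g2 (x3 P) = - x3 P by rewrite fx3 tg2 expr1 mulN1r.
split; split.
- by rewrite fx1 sg1.
- by rewrite fx2 sg1.
- exact: x3g1.
- by rewrite fx1 sg2.
- by rewrite fx2 sg2.
- exact: x3g2.
Qed.

Fact rel_A_natural : natural_family (@rel_A k).
Proof.
move=> B B' f w1 w2 w3; rewrite /rel_A /bracket /anticomm !expr2 /=.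
by congr [:: _; _; _; _]; rewrite !(raddfB, raddfD, linearZ, rmorphM) /=
  ?(raddfB, raddfD, linearZ, rmorphM) /= ?rmorphM.
Qed.

Fact rel_A_sign : sign_family (@rel_A k).
Proof.
move=> B w1 w2 w3 b c; rewrite /rel_A /bracket /anticomm !expr2 /=.
case/and5P => h1 h2 h3 h4 _; apply/and5P; split=> //; move: h1 h2 h3 h4;
  rewrite ?(mulrDl, mulrDr, mulrN, mulNr, opprD, opprK, mulrA, addrA) => h1 h2 h3 h4;
  case: b; case: c; rewrite ?(expr0, expr1, mul1r, mulr1, mulrN, mulNr,
    opprD, opprK, scalerN) //; by rewrite -oppr_eq0 ?(opprD, opprK).
Qed.

Lemma swap_action_A :
  exists rho : alg_action klein (presented (pres_A k)),
    swap_action rho.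
Proof.
by apply: (@swap_action_exists _ (pres_A k) rel_A_natural rel_A_sign).
Qed.

Fact rel_B_natural : natural_family (@rel_B k).
Proof.
move=> B B' f w1 w2 w3; rewrite /rel_B /bracket /anticomm !expr2 /=.
by congr [:: _; _; _; _]; rewrite !(raddfB, raddfD, linearZ, rmorphM) /=
  ?(raddfB, raddfD, linearZ, rmorphM) /= ?rmorphM.
Qed.

Fact rel_B_sign : sign_family (@rel_B k).
Proof.
move=> B w1 w2 w3 b c; rewrite /rel_B /bracket /anticomm !expr2 /=.
case/and5P => h1 h2 h3 h4 _; apply/and5P; split=> //; move: h1 h2 h3 h4;
  rewrite ?(mulrDl, mulrDr, mulrN, mulNr, opprD, opprK, mulrA, addrA) => h1 h2 h3 h4;
  case: b; case: c; rewrite ?(expr0, expr1, mul1r, mulr1, mulrN, mulNr,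
    opprD, opprK, scalerN) //; by rewrite -oppr_eq0 ?(opprD, opprK).
Qed.

Lemma swap_action_B :
  exists rho : alg_action klein (presented (pres_B k)),
    swap_action rho.
Proof.
by apply: (@swap_action_exists _ (pres_B k) rel_B_natural rel_B_sign).
Qed.

Fact rel_E_natural (gamma : k) : natural_family (fun B w1 w2 w3 => @rel_E k B w1 w2 w3 gamma).
Proof.
move=> B B' f w1 w2 w3; rewrite /rel_E /bracket /anticomm !expr2 /=.
by congr [:: _; _; _; _]; rewrite !(raddfB, raddfD, linearZ, rmorphM) /=
  ?(raddfB, raddfD, linearZ, rmorphM) /= ?rmorphM.
Qed.

Fact rel_E_sign (gamma : k) : sign_family (fun B w1 w2 w3 => @rel_E k B w1 w2 w3 gamma).
Proof.
move=> B w1 w2 w3 b c; rewrite /rel_E /bracket /anticomm !expr2 /=.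
case/and5P => h1 h2 h3 h4 _; apply/and5P; split=> //; move: h1 h2 h3 h4;
  rewrite ?(mulrDl, mulrDr, mulrN, mulNr, opprD, opprK, mulrA, addrA) => h1 h2 h3 h4;
  case: b; case: c; rewrite ?(expr0, expr1, mul1r, mulr1, mulrN, mulNr,
    opprD, opprK, scalerN) //; by rewrite -oppr_eq0 ?(opprD, opprK).
Qed.

Lemma swap_action_E (gamma : k) :
  exists rho : alg_action klein (presented (pres_E gamma)),
    swap_action rho.
Proof.
by apply: (@swap_action_exists _ (pres_E gamma) (@rel_E_natural gamma)
  (@rel_E_sign gamma)).
Qed.

Fact rel_G_natural (gamma : k) : natural_family (fun B w1 w2 w3 => @rel_G k B w1 w2 w3 gamma).
Proof.
move=> B B' f w1 w2 w3; rewrite /rel_G /bracket /anticomm !expr2 /=.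
by congr [:: _; _; _; _]; rewrite !(raddfB, raddfD, linearZ, rmorphM) /=
  ?(raddfB, raddfD, linearZ, rmorphM) /= ?rmorphM.
Qed.

Fact rel_G_sign (gamma : k) : sign_family (fun B w1 w2 w3 => @rel_G k B w1 w2 w3 gamma).
Proof.
move=> B w1 w2 w3 b c; rewrite /rel_G /bracket /anticomm !expr2 /=.
move: (2 * gamma - 1) => d.
case/and5P => h1 h2 h3 h4 _; apply/and5P; split=> //; move: h1 h2 h3 h4;
  rewrite ?(mulrDl, mulrDr, mulrN, mulNr, opprD, opprK, mulrA, addrA) => h1 h2 h3 h4;
  case: b; case: c; rewrite ?(expr0, expr1, mul1r, mulr1, mulrN, mulNr,
    opprD, opprK, scalerN) //; by rewrite -oppr_eq0 ?(opprD, opprK).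
Qed.

Lemma swap_action_G (gamma : k) :
  exists rho : alg_action klein (presented (pres_G gamma)),
    swap_action rho.
Proof.
by apply: (@swap_action_exists _ (pres_G gamma) (@rel_G_natural gamma)
  (@rel_G_sign gamma)).
Qed.

End SwapAction.

(* Main.v *)
(* For the given action, w1, w2, w3 are homogeneous of degrees 1, g2, g1, so
   the twisted product multiplies a word in the w's by (-1)^n, where n is the
   number of pairs in which a w3 stands to the left of a w2. This sign change
   turns the relators of each source algebra P into those of the target Q, and
   conversely, which gives algebra maps Q -> P^(G,mu) and P -> Q^(G,mu). Both
   respect the grading, and mu^2 = 1, so each is also an algebra map out of the
   twisted source; as they exchange the generators, they are inverse to each
   other. *)

Require Import Defs.
From mathcomp Require Import all_boot all_order all_algebra all_fingroup.
From HB Require Import structures.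

Set Implicit Arguments.
Unset Strict Implicit.
Unset Printing Implicit Defensive.

Import GRing.Theory.
Local Open Scope ring_scope.

(** * Algebra maps into and out of a cocycle twist *)

Section TwistMorphisms.
Variables (k : fieldType) (G : finGroupType) (chi : dual_iso k G).

(** Values of characters commute in [k], and [chi] embeds the group among the characters. *)
Lemma dual_iso_abelian (g h : G) : (g * h)%g = (h * g)%g.
Proof. by apply: (dual_inj (d := chi)) => x; rewrite !dual_mul mulrC. Qed.

Lemma hcomp_act (A : algType k) (rho : alg_action G A) g h a :
  hcomp chi rho g (rho h a) = rho h (hcomp chi rho g a).
Proof.
rewrite /hcomp [RHS]linearZ [X in _ = _ *: X]linear_sum /=; congr (_ *: _).
apply: eq_bigr => x _.
by rewrite linearZ /= -!alg_actM dual_iso_abelian.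
Qed.

(** The action commutes with every projection [hcomp], hence respects the twisted product too.
    Having it as a morphism of the twist lets [presented_ext] apply to maps composed with it. *)
Lemma twist_act (A : algType k) (mu : cocycle2 k G) (rho : alg_action G A) h :
  exists f : {lrmorphism twist chi mu rho -> twist chi mu rho},
    forall a, f a = rho h a.
Proof.
pose f (a : twist chi mu rho) : twist chi mu rho := rho h (a : A).
have fL : linear f by move=> c a b; apply: (linearP (rho h)).
have fM : monoid_morphism f.
  split=> [|a b]; first exact: (rmorph1 (rho h)).
  rewrite !twistM /f /twist_mul linear_sum; apply: eq_bigr => g _.
  rewrite linear_sum; apply: eq_bigr => l _.
  by rewrite !hcomp_act linearZ /= rmorphM.
pose fl := GRing.isLinear.Build k _ _ *:%R f fL.
pose fm := GRing.isMonoidMorphism.Build _ _ f fM.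
pose F : {lrmorphism twist chi mu rho -> twist chi mu rho} := HB.pack f fl fm.
by exists F.
Qed.

(** An equivariant [f] preserves degrees, so on components of degrees [g] and [h] the factor
    [mu g h] from the source cancels the factor [nu g h] from the target. *)
Lemma untwist (A B : algType k) (mu nu : cocycle2 k G)
    (rho : alg_action G A) (sigma : alg_action G B)
    (f : {lrmorphism A -> twist chi nu sigma}) :
  (forall g h, mu g h * nu g h = 1) ->
  (forall h a, f (rho h a) = sigma h (f a)) ->
  exists f' : {lrmorphism twist chi mu rho -> B}, forall a, f' a = f a.
Proof.
move=> munu fact.
have fh g a : homog chi rho g a -> homog chi sigma g (f a).
  by move=> ha h; rewrite -fact ha linearZ.
pose F (a : twist chi mu rho) : B := f (a : A).
have FL : linear F by move=> c a b; apply: (linearP f).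
have FM : monoid_morphism F.
  split=> [|a b]; first exact: (rmorph1 f).
  (* Only the right-hand side is decomposed: on the left, [twist_mul] is already a double sum over
     components. *)
  rewrite -{2}(sum_comp chi rho b) -{2}(sum_comp chi rho a).
  rewrite twistM /twist_mul /F !linear_sum mulr_suml; apply: eq_bigr => g _.
  rewrite linear_sum mulr_sumr; apply: eq_bigr => h _.
  have ha := homog_comp chi rho g a; have hb := homog_comp chi rho h b.
  rewrite linearZ /= rmorphM /= twistM (twist_mul_homog nu (fh _ _ ha) (fh _ _ hb)).
  by rewrite scalerA munu scale1r.
pose fl := GRing.isLinear.Build k _ _ *:%R F FL.
pose fm := GRing.isMonoidMorphism.Build _ _ F FM.
pose F' : {lrmorphism twist chi mu rho -> B} := HB.pack F fl fm.
by exists F'.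
Qed.

(** The equation is read in [A], so that relators evaluated in the twist can be compared with
    relators evaluated in [A]. *)
Lemma twist_prod2 (A : algType k) (mu : cocycle2 k G) (rho : alg_action G A)
    g h (a b : A) :
  homog chi rho g a -> homog chi rho h b ->
  (a : twist chi mu rho) * b = mu g h *: (a * b) :> A.
Proof. by move=> ha hb; rewrite twistM (twist_mul_homog mu ha hb). Qed.

Lemma twist_prod3 (A : algType k) (mu : cocycle2 k G) (rho : alg_action G A)
    g h l (a b c : A) :
  homog chi rho g a -> homog chi rho h b -> homog chi rho l c ->
  (a : twist chi mu rho) * b * c
    = (mu g h * mu (g * h)%g l) *: (a * b * c) :> A.
Proof.
move=> ha hb hc; rewrite (twist_prod2 mu ha hb) twistM.
rewrite (twist_mul_homog mu (homogZ _ (homogM ha hb)) hc).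
by rewrite -scalerAl scalerA mulrC.
Qed.

End TwistMorphisms.

(** * Twisting presented algebras by the Klein group *)

Section KleinTwist.
Variables (k : fieldType) (char0 : [pchar k] =i pred0).
Local Notation chi := (klein_dual char0).
Local Notation mu := (klein_cocycle k).

Lemma klein_cocycle_sq g h : mu g h * mu g h = 1.
Proof. by rewrite /= /klein_mu -expr2 sqrr_sign. Qed.

(** Every element is its own inverse, which removes the inverse from [homog], and both sides are
    multiplicative in the group element, so [g1] and [g2] suffice. *)
Lemma klein_homog (A : algType k) (rho : alg_action klein A) d a :
  rho g1 a = chi d g1 *: a -> rho g2 a = chi d g2 *: a -> homog chi rho d a.
Proof.
have dV : d^-1%g = d by case: (klein_cases d) => ->; apply/eqP.
move=> a1 a2 h; rewrite dV; case: (klein_cases h) => ->.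
- by rewrite alg_act1 dual_hom1 scale1r.
- exact: a1.
- exact: a2.
by rewrite alg_actM a1 linearZ /= a2 scalerA klein_chiM.
Qed.

(** Quantifying over all algebras makes the condition usable in both directions, on the source
    algebra and on the target. *)
Definition twists_to (R R' : word_family k) : Prop :=
  forall (A : algType k) (rho : alg_action klein A) (w1 w2 w3 : A),
  homog chi rho 1%g w1 -> homog chi rho g2 w2 -> homog chi rho g1 w3 ->
  all (fun r => r == 0) (R A w1 w2 w3) ->
  all (fun r => r == 0) (R' (twist chi mu rho) w1 w2 w3).

Definition presented_by (R : word_family k) (P : presentation k 3) : Prop :=
  relators P = R (free_alg k 3) (free_var k 0 + free_var k 1)
    (free_var k 0 - free_var k 1) (free_var k 2).

Lemma family_map (R : word_family k) (B : algType k)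
    (F : {lrmorphism free_alg k 3 -> B}) :
  natural_family R ->
  map F (R (free_alg k 3) (free_var k 0 + free_var k 1)
    (free_var k 0 - free_var k 1) (free_var k 2)) =
  R B (F (free_var k 0) + F (free_var k 1))
    (F (free_var k 0) - F (free_var k 1)) (F (free_var k 2)).
Proof.
move=> Rnat; rewrite (Rnat _ _ F); congr (R _ _ _ _).
  exact: (raddfD F).
exact: (raddfB F).
Qed.

Lemma twist_lift (R R' : word_family k) (P P' : presentation k 3)
    (rho : alg_action klein (presented P)) :
  natural_family R -> natural_family R' -> twists_to R R' ->
  presented_by R P -> presented_by R' P' -> swap_action rho ->
  exists f : {lrmorphism presented P' -> twist chi mu rho},
    forall i, f (gen P' i) = gen P i.
Proof.
move=> Rnat Rnat' RR' eP eP' [[r11 r12 r13] [r21 r22 r23]].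
pose y (i : 'I_3) : twist chi mu rho := gen P i.
apply: (presented_lift (y := y)).
pose F : {lrmorphism free_alg k 3 -> twist chi mu rho} := free_eval y.
suff : all (fun r => r == 0) (map F (relators P')) by rewrite all_map.
have Fv j : F (free_var k j) = gen P j by apply: free_eval_var.
rewrite eP' family_map // !Fv.
have R0 : all (fun r => r == 0)
    (R (presented P) (x1 P + x2 P) (x1 P - x2 P) (x3 P)).
  pose pi : {lrmorphism free_alg k 3 -> presented P} := @pres_pi k 3 P.
  have <- := family_map pi Rnat; rewrite -eP all_map.
  apply/allP => r rP /=; apply/eqP/pres_pi0P/rel_idealP; exact: IdealGenIn.
(* Since [chi g g = 1], the degree is opposite to the generator that changes the sign: [w2] is
   negated by [g1] alone and has degree [g2], while [w3] is negated by [g2] alone and has degree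
   [g1]. *)
apply: (RR' _ rho _ _ _ _ _ _ R0); apply: klein_homog.
- by rewrite raddfD /= r11 r12 addrC /klein_chi /= scale1r.
- by rewrite raddfD /= r21 r22 /klein_chi /= scale1r.
- by rewrite raddfB /= r11 r12 /klein_chi /= scaleN1r opprB.
- by rewrite raddfB /= r21 r22 /klein_chi /= scale1r.
- by rewrite r13 /klein_chi /= scale1r.
- by rewrite r23 /klein_chi /= scaleN1r.
Qed.

(** For fixed [h] both sides are algebra maps into the twist, so they are compared on the generators
    of the algebra, and only for [h] among the generators of the group. *)
Lemma swap_equivariant (P Q : presentation k 3)
    (rho : alg_action klein (presented P))
    (sigma : alg_action klein (presented Q))
    (f : {lrmorphism presented P -> twist chi mu sigma}) :
  swap_action rho -> swap_action sigma ->
  (forall i, f (gen P i) = gen Q i) ->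
  forall h a, f (rho h a) = sigma h (f a).
Proof.
move=> [[r11 r12 r13] [r21 r22 r23]] [[s11 s12 s13] [s21 s22 s23]] fE.
have base g : (forall i, f (rho g (gen P i)) = sigma g (gen Q i)) ->
    forall a, f (rho g a) = sigma g (f a).
  move=> eg a; have [s sE] := twist_act chi mu sigma g; rewrite -sE.
  pose fr : {lrmorphism presented P -> twist chi mu sigma} := f \o rho g.
  pose sf : {lrmorphism presented P -> twist chi mu sigma} := s \o f.
  apply: (presented_ext (f := fr) (g := sf)) => i.
  by rewrite /= sE fE eg.
have e1 a : f (rho g1 a) = sigma g1 (f a).
  apply: base => i; case: (I3_cases i) => ->.
  - by rewrite r11 s11 fE.
  - by rewrite r12 s12 fE.
  - by rewrite r13 s13 fE.
have e2 a : f (rho g2 a) = sigma g2 (f a).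
  apply: base => i; case: (I3_cases i) => ->.
  - by rewrite r21 s21 fE.
  - by rewrite r22 s22 fE.
  - by rewrite r23 s23 raddfN /= fE.
move=> h a; case: (klein_cases h) => -> //; first by rewrite !alg_act1.
by rewrite !alg_actM e2 e1.
Qed.

Lemma twist_iso (R R' : word_family k) (P P' : presentation k 3)
    (rho : alg_action klein (presented P)) :
  natural_family R -> natural_family R' -> sign_family R' ->
  twists_to R R' -> twists_to R' R ->
  presented_by R P -> presented_by R' P' -> swap_action rho ->
  alg_iso (twist chi mu rho) (presented P').
Proof.
move=> Rnat Rnat' Rsign' RR' R'R eP eP' rhoE.
have [sigma sigmaE] := swap_action_exists Rnat' Rsign' eP'.
have [f fE] := twist_lift Rnat Rnat' RR' eP eP' rhoE.
have [g gE] := twist_lift Rnat' Rnat R'R eP' eP sigmaE.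
have [f' f'E] := untwist klein_cocycle_sq (swap_equivariant sigmaE rhoE fE).
have [g' g'E] := untwist klein_cocycle_sq (swap_equivariant rhoE sigmaE gE).
exists g', f => a.
(* This composite starts at the twist, which is not given by a presentation. Rewritten as [f'] after
   [g], it becomes an endomorphism of [presented P], determined by its values on generators. *)
- rewrite g'E -f'E.
  pose fg : {lrmorphism presented P -> presented P} := f' \o g.
  pose idm : {lrmorphism presented P -> presented P} := idfun.
  by apply: (presented_ext (f := fg) (g := idm)) => i; rewrite /= gE f'E fE.
pose gf : {lrmorphism presented P' -> presented P'} := g' \o f.
pose idm : {lrmorphism presented P' -> presented P'} := idfun.
by apply: (presented_ext (f := gf) (g := idm)) => i; rewrite /= fE g'E gE.
Qed.

Lemma twist_words2 (A : algType k) (rho : alg_action klein A) (w1 w2 w3 : A) :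
  homog chi rho 1%g w1 -> homog chi rho g2 w2 -> homog chi rho g1 w3 ->
  let t := twist chi mu rho in
  ((w1 : t) * w1 = w1 * w1 :> A) * ((w2 : t) * w2 = w2 * w2 :> A) *
  ((w3 : t) * w1 = w3 * w1 :> A) * ((w1 : t) * w3 = w1 * w3 :> A).
Proof.
move=> h1 h2 h3 t; do ![split]; rewrite /t.
- by rewrite (twist_prod2 _ h1 h1) /= /klein_mu expr0 scale1r.
- by rewrite (twist_prod2 _ h2 h2) /= /klein_mu expr0 scale1r.
- by rewrite (twist_prod2 _ h3 h1) /= /klein_mu expr0 scale1r.
- by rewrite (twist_prod2 _ h1 h3) /= /klein_mu expr0 scale1r.
Qed.

(** These are the cubic words of all the relators. In [w3 * w3 * w2] two pairs contribute, so the
    signs cancel. *)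
Lemma twist_words3 (A : algType k) (rho : alg_action klein A) (w1 w2 w3 : A) :
  homog chi rho 1%g w1 -> homog chi rho g2 w2 -> homog chi rho g1 w3 ->
  let t := twist chi mu rho in
  ((w3 : t) * w1 * w2 = - (w3 * w1 * w2) :> A) *
  ((w3 : t) * w2 * w1 = - (w3 * w2 * w1) :> A) *
  ((w1 : t) * w3 * w2 = - (w1 * w3 * w2) :> A) *
  ((w3 : t) * w3 * w2 = w3 * w3 * w2 :> A) *
  ((w2 : t) * w3 * w3 = w2 * w3 * w3 :> A) *
  ((w1 : t) * w2 * w3 = w1 * w2 * w3 :> A) *
  ((w2 : t) * w1 * w3 = w2 * w1 * w3 :> A).
Proof.
move=> h1 h2 h3 t; do ![split]; rewrite /t.
- by rewrite (twist_prod3 _ h3 h1 h2) /= /klein_mu /= expr0 mul1r expr1 scaleN1r.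
- by rewrite (twist_prod3 _ h3 h2 h1) /= /klein_mu /= expr0 mulr1 expr1 scaleN1r.
- by rewrite (twist_prod3 _ h1 h3 h2) /= /klein_mu /= expr0 mul1r expr1 scaleN1r.
- by rewrite (twist_prod3 _ h3 h3 h2) /= /klein_mu /= !expr0 mulr1 scale1r.
- by rewrite (twist_prod3 _ h2 h3 h3) /= /klein_mu /= !expr0 mulr1 scale1r.
- by rewrite (twist_prod3 _ h1 h2 h3) /= /klein_mu /= !expr0 mulr1 scale1r.
- by rewrite (twist_prod3 _ h2 h1 h3) /= /klein_mu /= !expr0 mulr1 scale1r.
Qed.

(* The words of length 3 are rewritten first, since twist_words2 would
   otherwise rewrite their prefixes. *)
Ltac expand_twisted h1 h2 h3 :=
  rewrite /rel_A /rel_B /rel_C /rel_D /rel_E /rel_G /bracket /anticomm !expr2 /=;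
  rewrite ?(mulrDl, mulrDr, mulrBl, mulrBr, mulrN, mulNr, mulrA);
  rewrite !(twist_words3 h1 h2 h3) !(twist_words2 h1 h2 h3);
  rewrite ?(opprD, opprK, addrA, scalerN, scaleNr).

(** * Effect of the twist on the fourth relators *)

(** Words beginning with [w3] change sign and words ending with it do not, so the twisted
    anticommutator of [w3] with [anticomm w1 w2] is minus the commutator in [A]. *)
Lemma twists_to_AD : twists_to (@rel_A k) (@rel_D k).
Proof.
move=> A rho w1 w2 w3 h1 h2 h3; expand_twisted h1 h2 h3.
case/and5P => r1 r2 r3 r4 _; apply/and5P; split=> //.
by rewrite -oppr_eq0 ?(opprD, opprK).
Qed.

Lemma twists_to_DA : twists_to (@rel_D k) (@rel_A k).
Proof.
move=> A rho w1 w2 w3 h1 h2 h3; expand_twisted h1 h2 h3.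
case/and5P => r1 r2 r3 r4 _; apply/and5P; split=> //.
by rewrite -oppr_eq0 ?(opprD, opprK).
Qed.

Lemma twists_to_BC : twists_to (@rel_B k) (@rel_C k).
Proof.
move=> A rho w1 w2 w3 h1 h2 h3; expand_twisted h1 h2 h3.
case/and5P => r1 r2 r3 r4 _; apply/and5P; split=> //.
(* As B uses [bracket w2 w1] and C uses [bracket w1 w2], the relators agree without a global sign,
   up to the order of the terms. *)
by rewrite addrAC [- _ + _]addrC.
Qed.

Lemma twists_to_CB : twists_to (@rel_C k) (@rel_B k).
Proof.
move=> A rho w1 w2 w3 h1 h2 h3; expand_twisted h1 h2 h3.
case/and5P => r1 r2 r3 r4 _; apply/and5P; split=> //.
by rewrite addrAC [- _ + _]addrC.
Qed.

Lemma twists_to_E (gamma : k) :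
  twists_to (fun B w1 w2 w3 => @rel_E k B w1 w2 w3 gamma)
    (fun B w1 w2 w3 => @rel_E k B w1 w2 w3 (- gamma)).
Proof.
move=> A rho w1 w2 w3 h1 h2 h3; expand_twisted h1 h2 h3.
case/and5P => r1 r2 r3 r4 _; apply/and5P; split=> //.
by rewrite -oppr_eq0 ?(opprD, opprK).
Qed.

(** The words beginning with [w3] are negated and so is the coefficient of the others, so the whole
    fourth relator is negated. *)
Lemma twists_to_G (gamma gamma' : k) : 2 * gamma' - 1 = - (2 * gamma - 1) ->
  twists_to (fun B w1 w2 w3 => @rel_G k B w1 w2 w3 gamma)
    (fun B w1 w2 w3 => @rel_G k B w1 w2 w3 gamma').
Proof.
move=> ec A rho w1 w2 w3 h1 h2 h3; rewrite /rel_G ec; move: (2 * gamma - 1) => c.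
expand_twisted h1 h2 h3.
case/and5P => r1 r2 r3 r4 _; apply/and5P; split=> //.
by rewrite -oppr_eq0 ?(opprD, opprK).
Qed.

End KleinTwist.

(** * Symmetries of the relators of C and D, which provide the action on these targets *)

Section TargetFamilies.
Variable k : fieldType.

Lemma rel_C_natural : natural_family (@rel_C k).
Proof.
move=> B B' f w1 w2 w3; rewrite /rel_C /bracket !expr2 /=.
by congr [:: _; _; _; _]; rewrite !(raddfB, rmorphM) /=
  ?(raddfB, rmorphM) /= ?rmorphM.
Qed.

Lemma rel_D_natural : natural_family (@rel_D k).
Proof.
move=> B B' f w1 w2 w3; rewrite /rel_D /anticomm !expr2 /=.
by congr [:: _; _; _; _]; rewrite !(raddfB, raddfD, rmorphM) /=
  ?(raddfD, rmorphM) /= ?rmorphM.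
Qed.

Lemma rel_C_sign : sign_family (@rel_C k).
Proof.
move=> B w1 w2 w3 b c; rewrite /rel_C /bracket /anticomm !expr2 /=.
case/and5P => r1 r2 r3 r4 _; apply/and5P; split=> //; move: r1 r2 r3 r4;
  rewrite ?(mulrDl, mulrDr, mulrN, mulNr, opprD, opprK, mulrA, addrA);
  move=> r1 r2 r3 r4;
  case: b; case: c;
  rewrite ?(expr0, expr1, mul1r, mulr1, mulrN, mulNr, opprD, opprK) //;
  by rewrite -oppr_eq0 ?(opprD, opprK).
Qed.

Lemma rel_D_sign : sign_family (@rel_D k).
Proof.
move=> B w1 w2 w3 b c; rewrite /rel_D /bracket /anticomm !expr2 /=.
case/and5P => r1 r2 r3 r4 _; apply/and5P; split=> //; move: r1 r2 r3 r4;
  rewrite ?(mulrDl, mulrDr, mulrN, mulNr, opprD, opprK, mulrA, addrA);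
  move=> r1 r2 r3 r4;
  case: b; case: c;
  rewrite ?(expr0, expr1, mul1r, mulr1, mulrN, mulNr, opprD, opprK) //;
  by rewrite -oppr_eq0 ?(opprD, opprK).
Qed.

End TargetFamilies.

Theorem theorem5p3 (k : closedFieldType) (char0 : [pchar k] =i pred0)
    (i : k) (i_sqr : i ^+ 2 = - 1) :
  let chi := klein_dual char0 in
  let mu := klein_cocycle k in
  [/\ forall rho : alg_action klein (presented (pres_A k)),
        swap_action rho ->
        alg_iso (twist chi mu rho) (presented (pres_D k)),
      forall rho : alg_action klein (presented (pres_B k)),
        swap_action rho ->
        alg_iso (twist chi mu rho) (presented (pres_C k)),
      forall gamma : k, gamma = i \/ gamma = - i ->
        forall rho : alg_action klein (presented (pres_E gamma)),
        swap_action rho ->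
        alg_iso (twist chi mu rho) (presented (pres_E (- gamma)))
    & let gamma := (1 + i) / 2 in
      let gamma' := (1 - i) / 2 in
      gamma' = 1 / (2 * gamma) /\
      forall rho : alg_action klein (presented (pres_G gamma)),
        swap_action rho ->
        alg_iso (twist chi mu rho) (presented (pres_G gamma'))].
Proof.
move=> chi mu.
have two0 : 2 != 0 :> k := klein_two_neq0 char0.
have E_iso gamma (rho : alg_action klein (presented (pres_E gamma))) :
    swap_action rho -> alg_iso (twist chi mu rho) (presented (pres_E (- gamma))).
  apply: (twist_iso (rel_E_natural gamma) (rel_E_natural (- gamma))) => //.
  - exact: rel_E_sign.
  - exact: twists_to_E.
  (* The way back is the same twist, started from [- gamma]. *)
  - by rewrite -{2}[gamma]opprK; apply: twists_to_E.
split=> [rho|rho|gamma _|gamma gamma'].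
- apply: (twist_iso (@rel_A_natural k) (@rel_D_natural k) (@rel_D_sign k)) => //.
    exact: twists_to_AD.
  exact: twists_to_DA.
- apply: (twist_iso (@rel_B_natural k) (@rel_C_natural k) (@rel_C_sign k)) => //.
    exact: twists_to_BC.
  exact: twists_to_CB.
- exact: E_iso.
(* This makes [1 + i] nonzero with inverse [(1 - i) / 2], which is the identity claimed for
   [gamma']. *)
have normi : (1 - i) * (1 + i) = 2.
  by rewrite -subr_sqr i_sqr expr1n opprK.
(* [rel_G] depends on its parameter only through this coefficient; [gamma] and [gamma'] give
   opposite values, as [twists_to_G] requires. *)
have c_gamma : 2 * gamma - 1 = i.
  by rewrite /gamma mulrCA divff // mulr1 addrC addKr.
have c_gamma' : 2 * gamma' - 1 = - i.
  by rewrite /gamma' mulrCA divff // mulr1 addrC addKr.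
split.
  have i1 : 1 + i != 0.
    by apply: contraNneq two0 => i0; rewrite -normi i0 mulr0.
  rewrite /gamma' /gamma mulrCA divff // mulr1 div1r.
  by apply: (mulIf i1); rewrite mulVf // mulrAC normi divff.
move=> rho; apply: (twist_iso (rel_G_natural gamma) (rel_G_natural gamma')) => //.
- exact: rel_G_sign.
- by apply: twists_to_G; rewrite c_gamma c_gamma'.
- by apply: twists_to_G; rewrite c_gamma c_gamma' opprK.
Qed.
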